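(* There does not exist any finite constant $c$ such that the inequality $$l_v(g)\,l_\sigma(g)\le c\cdot \mathrm{vol}(g)$$ holds for every Riemannian metric $g$ on the Klein bottle $K$.
   Context: The Klein bottle $K$ is the quotient of $\mathbb{R}^2=\mathbb{C}$ by the group generated by $\sigma: z\mapsto \bar z+\pi$ and $t: z\mapsto z+2i\beta$, where $\beta>0$; this group is identified with $\pi_1(K)$, and $g_\beta$ denotes the induced flat metric. Every Riemannian metric on $K$ is conformally equivalent to $g_\beta$ for some $\beta>0$. $\mathrm{vol}(g)$ is the total area. Lengths, measured with respect to $g$: - $l_\sigma(g)$: least length of a closed curve in the free homotopy class of the glide reflection $\sigma$; - $l_v(g)$: least length of a closed curve in the free homotopy class of the vertical translation $t$. *)

(* Defs.v *)
From HB Require Import structures.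
From mathcomp Require Import all_boot all_order all_algebra generic_quotient.
From mathcomp Require Import all_classical all_reals all_analysis.

Set Implicit Arguments.
Unset Strict Implicit.
Unset Printing Implicit Defensive.

Import Order.TTheory GRing.Theory Num.Theory.
Import numFieldNormedType.Exports.

Local Open Scope classical_set_scope.
Local Open Scope ring_scope.
Local Open Scope quotient_scope.

(* The complex plane C = R^2, with z = x + i y encoded as (x, y). *)
Notation plane R := (R^o * R^o)%type.

Section KleinBottle.
Variables (R : realType) (beta : R).

Definition sigma (z : plane R) : plane R := (z.1 + pi, - z.2).

Definition vtrans (z : plane R) : plane R := (z.1, z.2 + 2 * beta).

(* The subgroup of the bijections of the plane generated by sigma and vtrans. *)
Inductive deck : (plane R -> plane R) -> Prop :=
| deck_id : deck id
| deck_sigma : deck sigma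
| deck_vtrans : deck vtrans
| deck_comp f g : deck f -> deck g -> deck (f \o g)
| deck_inv f g : deck f -> cancel f g -> cancel g f -> deck g.

Definition same_orbit (z w : plane R) : bool :=
  `[< exists f, deck f /\ w = f z >].

Lemma sigma_bij : bijective sigma.
Proof.
exists (fun z => (z.1 - pi, - z.2)) => -[x y].
- by rewrite /sigma /= addrK opprK.
- by rewrite /sigma /= subrK opprK.
Qed.

Lemma vtrans_bij : bijective vtrans.
Proof.
exists (fun z => (z.1, z.2 - 2 * beta)) => -[x y].
- by rewrite /vtrans /= addrK.
- by rewrite /vtrans /= subrK.
Qed.

Lemma deck_bij f : deck f -> bijective f.
Proof.
elim=> {f}; first by exists id.
- exact: sigma_bij.
- exact: vtrans_bij.
- by move=> f g _ bf _ bg; exact: bij_comp.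
- by move=> f g _ _ fK gK; exists f.
Qed.

Lemma same_orbit_equiv : equiv_class_of same_orbit.
Proof.
split.
- by move=> z; apply/asboolP; exists id; split => //; exact: deck_id.
- suff sym z w : same_orbit z w -> same_orbit w z.
    by move=> z w; apply/idP/idP; exact: sym.
  move=> /asboolP[f [df ->]]; have [g fK gK] := deck_bij df.
  by apply/asboolP; exists g; split; [exact: deck_inv fK gK | rewrite fK].
- move=> w z u /asboolP[f [df ->]] /asboolP[g [dg ->]].
  by apply/asboolP; exists (g \o f); split => //; exact: deck_comp.
Qed.

Canonical same_orbit_equiv_rel := EquivRelPack same_orbit_equiv.

Definition klein : topologicalType :=
  quotient_topology {eq_quot same_orbit_equiv_rel}.

Definition klein_proj (z : plane R) : klein :=
  \pi_(quotient_topology {eq_quot same_orbit_equiv_rel}) z.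

(* Iterated directional derivative of h along the vectors of s. *)
Definition iter_derive (s : seq (plane R)) (h : plane R -> R^o) :
    plane R -> R^o :=
  foldr (fun v k z => 'D_v k z) h s.

(* C^infinity; differentiability is that of Frechet, hence implies
   continuity, for all the iterated derivatives. *)
Definition smooth (h : plane R -> R^o) : Prop :=
  forall s z, differentiable (iter_derive s h) z.

(* A Riemannian metric on the Klein bottle, given by its pullback to the
   universal cover: a smooth field of scalar products on the tangent spaces
   of the plane, for which sigma and vtrans (hence all deck transformations)
   are isometries. *)
Definition isometric (g : plane R -> plane R -> plane R -> R)
    (f : plane R -> plane R) : Prop :=
  forall z u v, g (f z) ('D_u f z) ('D_v f z) = g z u v.

Record klein_metric := KleinMetric {
  metric_at :> plane R -> plane R -> plane R -> R;
  metric_linear : forall z a u v w,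
    metric_at z (a *: u + v) w = a * metric_at z u w + metric_at z v w;
  metric_sym : forall z u v, metric_at z u v = metric_at z v u;
  metric_pos : forall z u, u != 0 -> 0 < metric_at z u u;
  metric_smooth : forall u v, smooth (fun z => metric_at z u v);
  metric_sigma : isometric metric_at sigma;
  metric_vtrans : isometric metric_at vtrans }.

(* The rectangle [0, pi] x [0, 2 beta] is a fundamental domain of the deck
   group (up to its boundary), and the area element is sqrt (det g) dx dy. *)
Definition vol (g : klein_metric) : R :=
  \int[(lebesgue_measure \x lebesgue_measure)%E]_(z in `[0, pi] `*` `[0, 2 * beta])
    Num.sqrt (g z (1, 0) (1, 0) * g z (0, 1) (0, 1) - g z (1, 0) (0, 1) ^+ 2).

Definition C1 (c : R -> plane R) : Prop :=
  (forall t, derivable c t 1) /\ continuous (derive1 c).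

(* Each closed piece is the restriction of a curve that is C^1 on the line. *)
Definition piecewise_C1 (c : R -> plane R) : Prop :=
  exists s : seq R, [/\ path <%R 0 s, last 0 s = 1 &
    forall i, (i < size s)%N -> exists2 d : R -> plane R, C1 d &
      {in `[nth 0 (0 :: s) i, nth 0 s i], c =1 d}].

(* derive1 c may be undefined at the finitely many break points only. *)
Definition curve_length (g : klein_metric) (c : R -> plane R) : R :=
  \int[lebesgue_measure]_(t in `[0, 1])
    Num.sqrt (g (c t) (derive1 c t) (derive1 c t)).

(* Loops are parametrized by [0, 1]; their values elsewhere are irrelevant. *)
Definition freely_homotopic (a b : R -> klein) : Prop :=
  exists H : R * R -> klein,
    [/\ {within `[0, 1] `*` `[0, 1], continuous H},
        forall t, t \in `[0, 1] -> H (0, t) = a t,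
        forall t, t \in `[0, 1] -> H (1, t) = b t &
        forall s, s \in `[0, 1] -> H (s, 0) = H (s, 1)].

(* The loop representing the deck transformation f under the identification
   of the deck group with pi_1: the projection of a path from 0 to f 0. *)
Definition deck_loop (f : plane R -> plane R) (t : R) : klein :=
  klein_proj (t *: f 0).

(* The piecewise C^1 closed curves in the free homotopy class of f; a curve
   in the Klein bottle is given by a lift c to the plane. *)
Definition closed_curve_in_class (f : plane R -> plane R)
    (c : R -> plane R) : Prop :=
  [/\ piecewise_C1 c, klein_proj (c 0) = klein_proj (c 1) &
      freely_homotopic (klein_proj \o c) (deck_loop f)].

Definition least_length (g : klein_metric) (f : plane R -> plane R) : R :=
  inf [set curve_length g c | c in closed_curve_in_class f].

Definition l_sigma (g : klein_metric) : R := least_length g sigma.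

Definition l_v (g : klein_metric) : R := least_length g vtrans.

End KleinBottle.

(* Main.v *)
(* Take g = w(y)^2 dx^2 + Q^2 dy^2, with w even and 2 beta-periodic, w >= 1/2 on
   a strip |y| < d and w of small integral over a period.  A curve in the class
   of t climbs by 2 beta, so its length is at least 2 beta Q.  A curve in the
   class of sigma is a path from z to a reflection of z in some line
   y = 2 j beta translated by pi: it either stays in the strip around that line,
   and has length at least pi/2, or climbs by at least d/2, hence has length at
   least pi/2 for Q = pi/d.  The area is pi Q times the integral of w, so the
   ratio is at least beta divided by that integral.  For w we take
   cos(pi y / (2 beta))^(2n) + 1/(n+1), whose integral tends to 0. *)

Require Import Defs.
From mathcomp Require Import all_boot all_order all_algebra.
From mathcomp Require Import all_classical all_reals all_analysis.
From mathcomp Require Import ring lra zify.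
From mathcomp Require Import measurable_realfun.

Set Implicit Arguments.
Unset Strict Implicit.
Unset Printing Implicit Defensive.

Import Order.TTheory GRing.Theory Num.Theory.
Import numFieldNormedType.Exports.
Local Open Scope classical_set_scope.
Local Open Scope ring_scope.

(** * Deck transformations and fibers *)

Section DeckGroup.
Variables (R : realType) (beta : R).
Hypothesis beta_gt0 : 0 < beta.
Implicit Types (f g : plane R -> plane R) (x y z w : plane R) (e : R).

(* The deck transformation t^k sigma^n. *)
Definition deck_nf (n k : int) z : plane R :=
  (z.1 + n%:~R * pi, (-1) ^ n * z.2 + k%:~R * (2 * beta)).

Lemma expN1z_pm (n : int) : (-1) ^ n = 1 :> R \/ (-1) ^ n = -1 :> R.
Proof.
have h (m : nat) : (-1) ^+ m = 1 :> R \/ (-1) ^+ m = -1 :> R.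
  by rewrite -signr_odd; case: (odd m); [right|left].
case: n => m; first exact: h.
by rewrite NegzE -invr_expz -exprnP; case: (h m.+1) => ->;
  [left; rewrite invr1|right; rewrite invrN1].
Qed.

(** The sign must be available as an integer because it multiplies the exponent of t when normal
    forms are composed or inverted. *)
Lemma expN1z_int (n : int) : exists m : int, (-1) ^ n = m%:~R :> R.
Proof. by case: (expN1z_pm n) => ->; [exists 1|exists (-1); rewrite rmorphN1]. Qed.

Lemma normr_expN1z (n : int) : `|(-1) ^ n : R| = 1.
Proof. by case: (expN1z_pm n) => ->; rewrite ?normrN1 ?normr1. Qed.

(** The relation sigma t = t^-1 sigma lets every power of t be moved to the left. *)
Lemma deck_nfP f : deck beta f -> exists n k : int, f =1 deck_nf n k.
Proof.
elim=> {f}.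
- by exists 0, 0 => -[x y]; congr pair; rewrite /= ?expr0z; ring.
- by exists 1, 0 => -[x y]; congr pair; rewrite /= ?expr1z; ring.
- by exists 0, 1 => -[x y]; congr pair; rewrite /= ?expr0z; ring.
- move=> f g _ [n [k fE]] _ [m [l gE]].
  have [s sE] := expN1z_int n.
  exists (m + n), (s * l + k) => -[x y]; rewrite /= gE fE /deck_nf/=.
  rewrite !(intrD, intrM) expfzDr ?oppr_eq0 ?oner_eq0// -sE.
  by congr pair; ring.
- move=> f g _ [n [k fE]] fK gK.
  have [s sE] := expN1z_int n.
  exists (- n), (- s * k) => z.
  rewrite -[in RHS](gK z) fE /deck_nf/= -invr_expz !(intrN, intrM) -sE.
  case: (g z) => x y/=; congr pair; first by ring.
  by case: (expN1z_pm n) => ->; rewrite ?invrN1 ?invr1; ring.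
Qed.

(** The sup-norm ball, kept as two coordinate bounds since a deck transformation acts on each
    coordinate by an isometry of the line. *)
Definition close e z w := `|z.1 - w.1| < e /\ `|z.2 - w.2| < e.

Lemma close_sym e z w : close e z w -> close e w z.
Proof. by case=> *; split; rewrite distrC. Qed.

Lemma close_trans e1 e2 y z w :
  close e1 z y -> close e2 y w -> close (e1 + e2) z w.
Proof.
move=> [a b] [c d]; split; [rewrite -(subrKA y.1)|rewrite -(subrKA y.2)];
  by rewrite (le_lt_trans (ler_normD _ _))// ltrD.
Qed.

Lemma close_le e1 e2 z w : e1 <= e2 -> close e1 z w -> close e2 z w.
Proof. by move=> e12 [a b]; split; exact: lt_le_trans e12. Qed.

Lemma deck_close f e z w : deck beta f -> close e z w -> close e (f z) (f w).
Proof.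
move=> /deck_nfP[n [k fE]] [a b]; rewrite !fE; split=> /=.
  by rewrite opprD addrACA subrr addr0.
by rewrite opprD addrACA subrr addr0 -mulrBr normrM normr_expN1z mul1r.
Qed.

Definition deck_sep : R := Num.min pi (2 * beta).

Lemma deck_sep_gt0 : 0 < deck_sep.
Proof. by rewrite lt_min pi_gt0/= mulr_gt0. Qed.

Lemma normr_intM_lt (n : int) (a : R) : 0 < a -> `|n%:~R * a| < a -> n = 0.
Proof.
move=> a0; rewrite normrM (gtr0_norm a0) -ltr_pdivlMr// divff ?gt_eqF//.
by rewrite -intr_norm ltrz1; lia.
Qed.

(** Proper discontinuity and freeness of the action: closeness of abscissas forces n = 0, the sign
    then disappears, and closeness of ordinates forces k = 0. *)
Lemma deck_close_id f z : deck beta f -> close deck_sep (f z) z -> f =1 id.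
Proof.
move=> /deck_nfP[n [k fE]]; rewrite /close /deck_sep !lt_min fE/=.
have -> : z.1 + n%:~R * pi - z.1 = n%:~R * pi by ring.
move=> [/andP[/(normr_intM_lt (pi_gt0 R)) n0 _]].
rewrite {}n0 expr0z mul1r in fE *.
have -> : z.2 + k%:~R * (2 * beta) - z.2 = k%:~R * (2 * beta) by ring.
have b0 : 0 < 2 * beta by rewrite mulr_gt0.
move=> /andP[_ /(normr_intM_lt b0) k0] w.
by rewrite fE k0 /deck_nf expr0z mul1r !mul0r !addr0; case: w.
Qed.

Lemma klein_projP z w :
  klein_proj beta z = klein_proj beta w <-> exists f, deck beta f /\ w = f z.
Proof.
have piP := @eqmodP _ (same_orbit_equiv_rel beta) z w.
by split=> [/piP/asboolP//|h]; apply/piP/asboolP.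
Qed.

Lemma klein_proj_deck f z :
  deck beta f -> klein_proj beta (f z) = klein_proj beta z.
Proof. by move=> df; apply/esym/klein_projP; exists f. Qed.

Lemma same_fiber_close_eq z w : klein_proj beta z = klein_proj beta w ->
  close deck_sep z w -> z = w.
Proof.
move=> /klein_projP[f [df ->]] /close_sym /(deck_close_id df) fid.
by rewrite fid.
Qed.

Lemma same_fiber_close e z z' w : klein_proj beta z = klein_proj beta z' ->
  close e z w -> exists w', klein_proj beta w' = klein_proj beta w /\ close e z' w'.
Proof.
move=> /klein_projP[f [df ->]] zw; exists (f w); split.
  exact: klein_proj_deck.
exact: deck_close.
Qed.

Lemma klein_proj_continuous : continuous (klein_proj beta).
Proof. exact: pi_continuous. Qed.

Lemma klein_proj_open (z : plane R) e : 0 < e ->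
  nbhs (klein_proj beta z) [set klein_proj beta w | w in close e z].
Proof.
move=> e0; rewrite nbhsE/=; exists [set klein_proj beta w | w in close e z].
  2: by [].
split; last by exists z => //; split; rewrite subrr normr0.
rewrite /open/= /quotient_open openE => x/= [w [zw1 zw2] wx].
(* [d] is the distance from [w] to the boundary of the square around [z]. The [d]-square around [w]
   stays inside and is carried to [x] by a deck transformation. *)
set d := Num.min (e - `|z.1 - w.1|) (e - `|z.2 - w.2|).
have d0 : 0 < d by rewrite lt_min !subr_gt0 zw1.
rewrite /interior; apply/nbhs_ballP; exists d => //= y xy.
have {}xy : close d x y by move: xy; case.
have [y' [y'y wy']] := same_fiber_close (esym wx) xy.
exists y' => //; case: wy' => a b; split.
  rewrite -(subrKA w.1) (le_lt_trans (ler_normD _ _))// addrC -ltrBrDr.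
  by rewrite (lt_le_trans a)// ge_min lexx.
rewrite -(subrKA w.2) (le_lt_trans (ler_normD _ _))// addrC -ltrBrDr.
by rewrite (lt_le_trans b)// ge_min lexx orbT.
Qed.

End DeckGroup.

(** * Holonomy of a free homotopy class *)

(** Lebesgue number lemma, with [P] in the role of lying in a common member of the cover. The filter
    at 0+ in the near-covering property supplies one radius for all of [A]. *)
Lemma lebesgue_number (R : realType) (X : pseudoMetricType R) (A : set X)
    (P : X -> X -> Prop) : compact A ->
  (forall x, A x -> exists2 e, 0 < e &
    forall y y', A y -> A y' -> ball x e y -> ball x e y' -> P y y') ->
  exists2 d, 0 < d & forall y y', A y -> A y' -> ball y d y' -> P y y'.
Proof.
move=> /compact_near_coveringP/near_covering_withinP cA locP.
have [] := cA R 0^'+ (fun d y => forall y', A y' -> ball y d y' -> P y y').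
- move=> x Ax; have [e e0 xP] := locP x Ax.
  exists (ball x (e / 2), [set d | d < e / 2]) => /=.
    split; first by apply: nbhsx_ballx; rewrite divr_gt0.
    by apply: nbhs_right_lt; rewrite divr_gt0.
  move=> [y d]/= [xy de] Ay y' Ay' yy'; apply: xP => //.
    by apply: le_ball xy; rewrite ler_pdivrMr// ler_peMr ?ltW// ltr1n.
  by rewrite (splitr e); apply: (ball_triangle xy); apply: le_ball yy'; exact: ltW.
- move=> e /= e0 h; exists (e / 2); first by rewrite divr_gt0.
  move=> y y' Ay Ay' yy'; apply: (h (e / 2)) => //=; last by rewrite divr_gt0.
  rewrite sub0r normrN gtr0_norm ?divr_gt0// ltr_pdivrMr// ltr_pMr//.
  by rewrite ltr1n.
Qed.

Lemma uniform_close (R : realType) (X : pseudoMetricType R) (A : set X)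
    (c : X -> plane R) (e : R) : compact A -> {within A, continuous c} -> 0 < e ->
  exists2 d, 0 < d & forall t u, A t -> A u -> ball t d u -> close e (c t) (c u).
Proof.
move=> cA /subspace_continuousP cc e0; apply: lebesgue_number => // x Ax.
have e20 : 0 < e / 2 by rewrite divr_gt0.
have /nbhs_ballP[d /= d0 xd] := cc x Ax _ (nbhsx_ballx (c x) _ e20).
exists d => // y y' Ay Ay' /xd/(_ Ay)[a b] /xd/(_ Ay')[a' b'].
rewrite (splitr e); apply: (@close_trans _ _ _ (c x)); first exact: close_sym.
by split.
Qed.

Section Holonomy.
Variables (R : realType) (beta : R).
Hypothesis beta_gt0 : 0 < beta.
Local Notation proj := (klein_proj beta).
Local Notation sep := (deck_sep beta).

(** Heine-Cantor for maps into the quotient, where closeness is read on fibers. It replaces homotopy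
    lifting by a statement about finitely many grid points. *)
Lemma uniform_fiber_close (X : pseudoMetricType R) (A : set X)
    (H : X -> klein beta) (e : R) :
    compact A -> {within A, continuous H} -> 0 < e ->
  exists2 d, 0 < d & forall p q, A p -> A q -> ball p d q ->
    forall z, proj z = H p -> exists w, proj w = H q /\ close e z w.
Proof.
move=> cA /subspace_continuousP cH e0; apply: lebesgue_number => // x Ax.
have [z0 z0x] : exists z0, proj z0 = H x.
  by exists (repr (H x)); rewrite /klein_proj reprK.
have e20 : 0 < e / 2 by rewrite divr_gt0.
have := @klein_proj_open _ beta z0 _ e20; rewrite z0x => /(cH x Ax).
move=> /nbhs_ballP[d /= d0 xd].
exists d => // y y' Ay Ay' /xd/(_ Ay)[w z0w wy] /xd/(_ Ay')[w' z0w' wy'] z zy.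
have ww' : close e w w'.
  by rewrite (splitr e); exact: close_trans (close_sym z0w) z0w'.
(* The deck transformation taking [w] to [z] takes [w'] to the required point. *)
have [w'' [w''w' zw'']] := same_fiber_close (etrans wy (esym zy)) ww'.
by exists w''; split=> //; rewrite w''w'.
Qed.

(* [a j] is the value at j / N of a loop and f is the holonomy of its lift y. *)
Definition discrete_lift (f : plane R -> plane R) (N : nat) (a : nat -> klein beta)
    (y : nat -> plane R) :=
  [/\ forall j, (j <= N)%N -> proj (y j) = a j,
      forall j, (j < N)%N -> close (sep / 4) (y j) (y j.+1) &
      y N = f (y 0%N)].

Let sep4_gt0 : 0 < sep / 4. Proof. by rewrite divr_gt0 ?deck_sep_gt0. Qed.

(* Each point of the lift moves to the nearby point of the new fiber; since this
   choice is unique and commutes with f, the holonomy does not change. *)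
Lemma discrete_lift_step f N (a b : nat -> klein beta) y :
  deck beta f -> b 0%N = b N ->
  (forall j z, (j <= N)%N -> proj z = a j ->
    exists w, proj w = b j /\ close (sep / 4) z w) ->
  (forall j z, (j < N)%N -> proj z = b j ->
    exists w, proj w = b j.+1 /\ close (sep / 4) z w) ->
  discrete_lift f N a y -> exists y', discrete_lift f N b y'.
Proof.
move=> df b0N ab bb [ya yy yN].
have /choice[y' y'P] j : exists w, (j <= N)%N ->
    proj w = b j /\ close (sep / 4) (y j) w.
  have [jN|] := leqP j N; last by exists (y j).
  by have [w ?] := ab j (y j) jN (ya j jN); exists w.
exists y'; split.
- by move=> j /y'P[].
- move=> j jN; have [pj cj] := y'P j (ltnW jN); have [pj1 cj1] := y'P j.+1 jN.
  have [w [wb jw]] := bb j (y' j) jN pj.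
  suff -> : y' j.+1 = w by [].
  apply: (same_fiber_close_eq beta_gt0); first by rewrite pj1 wb.
  (* The quarter is chosen for this chain of four jumps, from [y' j.+1] through [y j.+1], [y j] and
     [y' j] to [w]. *)
  have -> : sep = sep / 4 + (sep / 4 + (sep / 4 + sep / 4)) by field.
  apply: (close_trans (close_sym cj1)); apply: (close_trans (close_sym (yy j jN))).
  exact: close_trans jw.
(* [y' N] and [f (y' 0)] lie in one fiber, and both are near [y N = f (y 0)]. *)
- have [p0 c0] := y'P 0%N (leq0n _); have [pN cN] := y'P N (leqnn _).
  apply: (same_fiber_close_eq beta_gt0).
    by rewrite pN klein_proj_deck// p0.
  apply: (@close_le _ (sep / 4 + sep / 4)).
    by have := sep4_gt0; lra.
  apply: (close_trans (close_sym cN)); rewrite yN.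
  exact: deck_close df _.
Qed.

(** Induction on [j]: the next points of both lifts share a fiber and are near the same point, hence
    coincide. *)
Lemma discrete_lift_unique f g N (a : nat -> klein beta) y u :
  deck beta g -> discrete_lift f N a y ->
  (forall j, (j <= N)%N -> proj (u j) = a j) ->
  (forall j, (j < N)%N -> close (sep / 4) (u j) (u j.+1)) ->
  y 0%N = g (u 0%N) -> forall j, (j <= N)%N -> y j = g (u j).
Proof.
move=> dg [ya yy _] ua uu y0; elim=> // j IH jN.
apply: (same_fiber_close_eq beta_gt0).
  by rewrite ya// klein_proj_deck// ua.
apply: (@close_le _ (sep / 4 + sep / 4)).
  by have := sep4_gt0; lra.
apply: (close_trans (close_sym (yy j jN))); rewrite (IH (ltnW jN)).
exact: deck_close dg (uu j jN).
Qed.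

(** The lift [c] of the first row of a fine grid, with holonomy [g], is carried row by row to the
    last row, where it is compared with the segment from 0 to [f 0]. The last equation is the
    conjugacy of [g] and [f], evaluated at 0. *)
Lemma free_homotopy_holonomy f (c : R -> plane R) : deck beta f ->
  {within `[0, 1], continuous c} -> proj (c 0) = proj (c 1) ->
  freely_homotopic (proj \o c) (deck_loop beta f) ->
  exists g h, [/\ deck beta g, deck beta h, c 1 = g (c 0) & g (h 0) = h (f 0)].
Proof.
move=> df cc /klein_projP[g [dg cg]] [H [cH H0 H1 HH]].
have cI : compact `[0%R, 1%R : R] by exact: segment_compact.
have cI2 := compact_setX cI cI.
have [d1 d10 cP] := uniform_close cI cc sep4_gt0.
have cl : {within `[0, 1], continuous (fun t : R => t *: f 0)}.
  by apply: continuous_subspaceT => t; apply: cvgZr_tmp; exact: cvg_id.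
have [d2 d20 lP] := uniform_close cI cl sep4_gt0.
have [d3 d30 HP] := uniform_fiber_close cI2 cH sep4_gt0.
(* One mesh for the lift [c], the final segment and the homotopy. *)
pose d := Num.min d1 (Num.min d2 d3).
have d0 : 0 < d by rewrite !lt_min d10 d20.
have [N N0 Nd] : exists2 N : nat, (0 < N)%N & N%:R^-1 < d.
  exists (Num.truncn d^-1).+1 => //.
  by rewrite invf_plt ?posrE ?ltr0n// truncnS_gt.
have NR : 0 < N%:R :> R by rewrite ltr0n.
pose t j : R := j%:R / N%:R.
have tI j : (j <= N)%N -> t j \in `[0, 1].
  by move=> jN; rewrite in_itv/= divr_ge0//= ler_pdivrMr// mul1r ler_nat.
have t0 : t 0%N = 0 by rewrite /t mul0r.
have tN : t N = 1 by rewrite /t divff ?gt_eqF.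
have tS j : ball (t j) d (t j.+1).
  rewrite /ball/= distrC -mulrBl -natrB// subSnn mul1r gtr0_norm ?invr_gt0//.
pose row i j := H (t i, t j).
have row0 : discrete_lift g N (row 0%N) (fun j => c (t j)).
  split=> [j jN|j jN|]; last by rewrite tN t0.
    by rewrite /row t0 H0 ?tI.
  apply: cP; [exact/tI/ltnW|exact: tI|].
  by apply: le_ball (tS j); rewrite ge_min lexx.
have d3d : d <= d3 by rewrite !ge_min lexx !orbT.
have rows i : (i <= N)%N -> exists y, discrete_lift g N (row i) y.
  elim: i => [_|i IH iN]; first by eexists; exact: row0.
  have [y yP] := IH (ltnW iN).
  apply: (discrete_lift_step dg _ _ _ yP).
  - by rewrite /row t0 tN HH ?tI.
  - move=> j z jN zj; apply: (HP _ _ _ _ _ _ zj).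
    + by split; apply: tI => //; exact: ltnW.
    + by split; exact: tI.
    + by split; [exact: le_ball (tS i)|exact: ballxx].
  - move=> j z jN zj; apply: (HP _ _ _ _ _ _ zj).
    + by split; apply: tI => //; exact: ltnW.
    + by split; exact: tI.
    + by split; [exact: ballxx|exact: le_ball (tS j)].
have [y yP] := rows N (leqnn N).
pose u j := t j *: f 0.
have ua j : (j <= N)%N -> proj (u j) = row N j.
  by move=> jN; rewrite /row tN H1 ?tI.
have uu j : (j < N)%N -> close (sep / 4) (u j) (u j.+1).
  move=> jN; apply: lP; [exact/tI/ltnW|exact: tI|].
  by apply: le_ball (tS j); rewrite !ge_min lexx orbT.
have [ya _ yN] := yP.
(* [h] compares the starting points of two lifts of the last row; by uniqueness it maps the whole
   segment to [y]. *)
have /klein_projP[h [dh y0]] : proj (u 0%N) = proj (y 0%N) by rewrite ua// ya.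
have yu := discrete_lift_unique dh yP ua uu y0.
exists g, h; split => //.
move: yN; rewrite (yu 0%N)// (yu N)// /u t0 tN scale0r scale1r.
by move=> ->.
Qed.

(** The conjugates of t are t and its inverse, hence the absolute value. *)
Lemma vtrans_class_endpoints (c : R -> plane R) : {within `[0, 1], continuous c} ->
  proj (c 0) = proj (c 1) ->
  freely_homotopic (proj \o c) (deck_loop beta (vtrans beta)) ->
  `|(c 1).2 - (c 0).2| = 2 * beta.
Proof.
move=> cc c01 /(free_homotopy_holonomy (deck_vtrans _) cc c01).
move=> [g [h [/deck_nfP[n [k gE]] /deck_nfP[m [l hE]] ->]]].
rewrite !hE !gE /deck_nf/vtrans/= !add0r => -[].
move=> /eqP; rewrite addrC -subr_eq0 addrK mulf_eq0 (gt_eqF (pi_gt0 R)) orbF.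
rewrite intr_eq0 => /eqP ->; rewrite expr0z !mul1r mulr0 add0r => kE.
have -> : (c 0).2 + k%:~R * (2 * beta) - (c 0).2 = (-1) ^ m * (2 * beta) by lra.
by rewrite normrM normr_expN1z mul1r gtr0_norm// mulr_gt0.
Qed.

(* The conjugates of sigma are the t^(2j) sigma, which reflect in y = 2 j beta. *)
Lemma sigma_class_endpoints (c : R -> plane R) : {within `[0, 1], continuous c} ->
  proj (c 0) = proj (c 1) ->
  freely_homotopic (proj \o c) (deck_loop beta (@sigma R)) ->
  (c 1).1 - (c 0).1 = pi /\
  exists j : int, (c 1).2 = - (c 0).2 + 2 * (j%:~R * (2 * beta)).
Proof.
move=> cc c01 /(free_homotopy_holonomy (deck_sigma _) cc c01).
move=> [g [h [/deck_nfP[n [k gE]] /deck_nfP[m [l hE]] ->]]].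
rewrite !hE !gE /deck_nf/sigma/= !add0r oppr0 !mulr0 !add0r => -[].
move=> /eqP; rewrite addrC (inj_eq (addIr _)) -{2}(mul1r pi) => /eqP.
move=> /(mulIf (lt0r_neq0 (pi_gt0 R))) n1.
have {n1} -> : n = 1 by apply: (@intr_inj R).
rewrite expr1z !mulN1r mul1r => kE; split; first by ring.
by exists l; lra.
Qed.

End Holonomy.

(** * Length of piecewise C1 curves *)

(** Induction on the subdivision, generalized to subdivisions of [a, 1]; it serves for both
    continuity and length. *)
Lemma piecewise_C1_ind (R : realType) (c : R -> plane R) (P : R -> R -> Prop) :
  (forall a, P a a) ->
  (forall a b e, a <= b -> b <= e -> P a b -> P b e -> P a e) ->
  (forall a b d, 0 <= a -> a < b -> b <= 1 -> C1 d ->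
    {in `[a, b], c =1 d} -> P a b) ->
  piecewise_C1 c -> P 0 1.
Proof.
move=> P0 Pcat PC1 [s [ps s1 sC1]].
suff {sC1} H a r : 0 <= a -> path <%R a r -> last a r = 1 ->
    (forall i, (i < size r)%N -> exists2 d : R -> plane R, C1 d &
      {in `[nth 0 (a :: r) i, nth 0 r i], c =1 d}) -> P a 1 /\ a <= 1.
  by have [] := H 0 s (lexx _) ps s1 sC1.
elim: r a => [|b r IH] a a0 /=; first by move=> _ -> _.
move=> /andP[ab br] r1 rC1.
have [Pb1 b1] : P b 1 /\ b <= 1.
  apply: IH => //; first by rewrite ltW// (le_lt_trans a0).
  by move=> i ir; apply: (rC1 i.+1).
split; last by rewrite ltW// (lt_le_trans ab).
apply: (Pcat _ _ _ (ltW ab) b1 _ Pb1).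
have [d dC1 cd] := rC1 0%N isT.
exact: PC1 dC1 cd.
Qed.

Lemma C1_continuous (R : realType) (d : R -> plane R) : C1 d -> continuous d.
Proof. by move=> [dd _] t; exact/differentiable_continuous/derivable1_diffP/dd. Qed.

Lemma itv_cc_setU (R : realType) (a b e : R) : a <= b -> b <= e ->
  `[a, e]%classic = `[a, b] `|` `[b, e].
Proof.
move=> ab be; apply/seteqP; split=> t/=; rewrite !in_itv/=; last first.
  by case=> /andP[? ?]; apply/andP; split=> //; apply: le_trans; eauto.
by move=> /andP[-> ->]; rewrite andbT; apply/orP; exact: le_total.
Qed.

Lemma piecewise_C1_continuous (R : realType) (c : R -> plane R) :
  piecewise_C1 c -> {within `[0, 1], continuous c}.
Proof.
apply: (@piecewise_C1_ind _ c (fun a b => {within `[a, b], continuous c})).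
- by move=> a; rewrite set_itv1; exact: continuous_subspace1.
- move=> a b e ab be cab cbe; rewrite (itv_cc_setU ab be).
  by apply: withinU_continuous => //; exact: interval_closed.
- move=> a b d _ _ _ /C1_continuous dC cd.
  have : {within `[a, b], continuous d} by exact: continuous_subspaceT.
  by apply: subspace_eq_continuous => t; rewrite inE => /cd.
Qed.

Section CurveLength.
Variables (R : realType) (sp : plane R -> plane R -> R) (a1 a2 : R).
Hypothesis sp_ge0 : forall z v, 0 <= sp z v.
Hypothesis sp_cont : forall f g : R -> plane R, continuous f -> continuous g ->
  continuous (fun t => sp (f t) (g t)).
Notation mu := (@lebesgue_measure R).
(** A constant 1-form used as a calibration: where the norm [sp] dominates it, its increments bound
    lengths from below. *)
Let l (z : plane R) : R := a1 * z.1 + a2 * z.2.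

Lemma is_derive_lin (d : R -> plane R) t : derivable d t 1 ->
  is_derive t 1 (l \o d) (l (derive1 d t)).
Proof.
move=> dt.
have h : h^-1 *: ((l \o d) (h *: 1 + t) - (l \o d) t) @[h --> 0^'] -->
    l (derive1 d t).
  rewrite derive1E.
  have -> : (fun h => h^-1 *: ((l \o d) (h *: 1 + t) - (l \o d) t)) =
      (fun h => l (h^-1 *: ((d (h *: 1 + t)) - d t))).
    by apply/funext => h /=; rewrite /l /= /GRing.scale/=; ring.
  have c := dt : _ --> 'D_1 d t.
  by apply: cvgD; apply: cvgMl_tmp; [apply: cvg_comp c cvg_fst|apply: cvg_comp c cvg_snd].
by split; [exact/cvgP/h|exact/cvg_lim].
Qed.

Lemma C1_lin_continuous (d : R -> plane R) : C1 d ->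
  continuous (fun t => l (derive1 d t)).
Proof.
move=> [_ cd] t; apply: cvgD; apply: cvgMl_tmp.
  by apply: cvg_comp (cd t) cvg_fst.
by apply: cvg_comp (cd t) cvg_snd.
Qed.

Definition speed (c : R -> plane R) t := sp (c t) (derive1 c t).

Lemma C1_speed_continuous (d : R -> plane R) : C1 d -> continuous (speed d).
Proof.
by move=> dC1; apply: sp_cont; [exact: C1_continuous|have [] := dC1].
Qed.

Lemma C1_lin_le (d : R -> plane R) (p q : R) : C1 d -> p <= q ->
  (forall t v, t \in `[p, q] -> l v <= sp (d t) v) ->
  ((l (d q) - l (d p))%:E <= \int[mu]_(t in `[p, q]) (speed d t)%:E)%E.
Proof.
(* The degenerate interval is set apart because the fundamental theorem of calculus requires
   [p < q]. *)
move=> dC1; rewrite le_eqVlt => /predU1P[->|pq] ld.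
  by rewrite subrr integral_ge0// => t _; rewrite lee_fin sp_ge0.
have cl := C1_lin_continuous dC1.
have cs := C1_speed_continuous dC1.
have [dd _] := dC1.
have ld' t := is_derive_lin (dd t).
rewrite EFinB -(@continuous_FTC2 _ (fun t => l (derive1 d t)) (l \o d))//.
- apply: le_integral => //.
  + apply: continuous_compact_integrable; first exact: segment_compact.
    exact: continuous_subspaceT.
  + apply: continuous_compact_integrable; first exact: segment_compact.
    exact: continuous_subspaceT.
  + by move=> t; rewrite inE/= => tpq; rewrite lee_fin ld.
- exact: continuous_subspaceT.
- have c t : {for t, continuous (l \o d)}.
    by apply/differentiable_continuous/derivable1_diffP; have [] := ld' t.
  split; first by move=> t _; have [] := ld' t.
  + by apply: cvg_at_right_filter; exact: c.
  + by apply: cvg_at_left_filter; exact: c.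
- by move=> t _; rewrite derive1E; apply: derive_val; exact: ld'.
Qed.

Section LengthOk.
Variable c : R -> plane R.

(** Measurability allows the integral to be split at break points. Finiteness matters because [fine]
    sends an infinite length to 0. *)
Definition length_ok (a b : R) := [/\
  measurable_fun `[a, b] (speed c),
  (\int[mu]_(t in `[a, b]) (speed c t)%:E < +oo)%E &
  forall p q, a <= p -> p <= q -> q <= b ->
    (forall t v, t \in `[p, q] -> l v <= sp (c t) v) ->
    ((l (c q) - l (c p))%:E <= \int[mu]_(t in `[p, q]) (speed c t)%:E)%E].

Lemma length_ok_refl a : length_ok a a.
Proof.
rewrite /length_ok set_itv1; split.
- exact: measurable_fun_set1.
- by rewrite integral_set1.
- move=> p q ap pq qa _.
  have -> : p = a by apply/eqP; rewrite eq_le ap (le_trans pq).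
  have -> : q = a by apply/eqP; rewrite eq_le qa (le_trans ap).
  by rewrite subrr integral_ge0// => t _; rewrite lee_fin sp_ge0.
Qed.

Lemma integral_speed_cat (p b q : R) : p <= b -> b <= q ->
  measurable_fun `[p, q] (speed c) ->
  (\int[mu]_(t in `[p, q]) (speed c t)%:E =
   \int[mu]_(t in `[p, b]) (speed c t)%:E + \int[mu]_(t in `[b, q]) (speed c t)%:E)%E.
Proof.
move=> pb bq mc.
have sE : `[p, q]%classic = `[p, b[ `|` `[b, q].
  by apply: itv_bndbnd_setU; rewrite bnd_simp.
have mE := mc; rewrite sE in mE.
rewrite sE ge0_integral_setU//=.
- congr (_ + _)%E; apply: integral_itv_bndo_bndc.
  apply/measurable_EFinP; apply: measurable_funS mE => //; exact: measurableU.
- exact/measurable_EFinP.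
- by move=> t _; rewrite lee_fin sp_ge0.
- rewrite disj_set2E; apply/eqP/seteqP; split=> t //=.
  by rewrite !in_itv/= => -[/andP[_ tb] /andP[]]; rewrite leNgt tb.
Qed.

Lemma length_ok_cat a b e : a <= b -> b <= e ->
  length_ok a b -> length_ok b e -> length_ok a e.
Proof.
move=> ab be [mab fab lab] [mbe fbe lbe].
have sE := itv_cc_setU ab be.
have mae : measurable_fun `[a, e] (speed c).
  by rewrite sE measurable_funU.
split => //.
- by rewrite (integral_speed_cat ab be mae); exact: lte_add_pinfty.
- move=> p q ap pq qe lc.
  have [qb|bq] := leP q b; first exact: lab.
  have [bp|pb] := leP b p; first exact: lbe.
  rewrite (integral_speed_cat (ltW pb) (ltW bq)); last first.
    apply: measurable_funS mae => //.
    by apply: subset_itv; rewrite bnd_simp.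
  rewrite -(subrKA (l (c b))) addrC EFinD; apply: leeD.
  + apply: lab => //; first exact: ltW.
    move=> t v; rewrite in_itv/= => /andP[pt tb]; apply: lc.
    by rewrite in_itv/= pt (le_trans tb (ltW bq)).
  + apply: lbe => //; first exact: ltW.
    move=> t v; rewrite in_itv/= => /andP[bt tq]; apply: lc.
    by rewrite in_itv/= tq (le_trans (ltW pb)).
Qed.

(** The derivatives of [c] and [d] are only known to agree in the open interval; the end points form
    a null set. *)
Lemma length_ok_C1 a b (d : R -> plane R) :
  a < b -> C1 d -> {in `[a, b], c =1 d} -> length_ok a b.
Proof.
move=> ab dC1 cd.
have cs := C1_speed_continuous dC1.
have scd : {in `]a, b[, speed c =1 speed d}.
  move=> t tab; rewrite /speed !derive1E.
  have -> : 'D_1 c t = 'D_1 d t.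
    apply: near_eq_derive; near=> u; apply: cd; apply: subset_itv_oo_cc; near: u.
    exact: near_in_itvoo.
  by rewrite (cd t (subset_itv_oo_cc tab)).
have msd A : measurable A -> measurable_fun A (speed d).
  by move=> mA; apply: measurable_funTS; exact: continuous_measurable_fun.
have ms : measurable_fun `]a, b[ (speed c).
  have e : {in `]a, b[%classic, speed d =1 speed c}.
    by move=> t; rewrite inE/= => tab; rewrite scd.
  exact: (eq_measurable_fun (speed d) e (msd _ (measurable_itv _))).
have iE p q : a <= p -> q <= b ->
    (\int[mu]_(t in `[p, q]) (speed c t)%:E =
     \int[mu]_(t in `[p, q]) (speed d t)%:E)%E.
  move=> ap qb.
  have sub : `]p, q[ `<=` `]a, b[ by apply: subset_itv; rewrite bnd_simp.
  rewrite [LHS]integral_itv_bndoo; first rewrite [RHS]integral_itv_bndoo.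
  - apply: eq_integral => t; rewrite inE/= => /sub/= tab.
    by rewrite scd.
  - by apply/measurable_EFinP; exact: msd.
  - by apply/measurable_EFinP; exact: measurable_funS ms.
split.
- exact: measurable_fun_itv_cc ms.
- rewrite iE//.
  have : mu.-integrable `[a, b] (EFin \o speed d).
    apply: continuous_compact_integrable; first exact: segment_compact.
    exact: continuous_subspaceT.
  move=> /integrableP[_]; apply: le_lt_trans; rewrite le_eqVlt; apply/orP; left.
  by apply/eqP/eq_integral => t _ /=; rewrite ger0_norm ?sp_ge0.
- move=> p q ap pq qb lc; rewrite iE//.
  have sub t : t \in `[p, q] -> t \in `[a, b].
    rewrite !in_itv/= => /andP[pt tq].
    by rewrite (le_trans ap pt) (le_trans tq qb).
  rewrite !cd ?sub ?in_itv/= ?lexx ?pq//; apply: C1_lin_le => // t v tpq.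
  by rewrite -cd ?lc// sub.
Unshelve. all: by end_near.
Qed.

Lemma piecewise_C1_length_ok : piecewise_C1 c -> length_ok 0 1.
Proof.
apply: piecewise_C1_ind.
- exact: length_ok_refl.
- exact: length_ok_cat.
- by move=> a b d _ ab _; exact: length_ok_C1.
Qed.

Lemma lin_le_length p q : piecewise_C1 c -> 0 <= p -> p <= q -> q <= 1 ->
  (forall t v, t \in `[p, q] -> l v <= sp (c t) v) ->
  l (c q) - l (c p) <= \int[mu]_(t in `[0, 1]) speed c t.
Proof.
move=> /piecewise_C1_length_ok[mc fc lc] p0 pq q1 lsp.
rewrite -lee_fin /Rintegral fineK; last first.
  rewrite ge0_fin_numE// integral_ge0// => t _; rewrite lee_fin; exact: sp_ge0.
apply: (le_trans (lc p q p0 pq q1 lsp)); apply: ge0_subset_integral => //.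
- exact/measurable_EFinP.
- by move=> t _; rewrite lee_fin; exact: sp_ge0.
- by apply: subset_itv; rewrite bnd_simp.
Qed.

End LengthOk.
End CurveLength.

(** * The metrics *)

Section TrigonometricPolynomials.
Variables (R : realType) (k : R).

(* The trigonometric polynomials in k y, an algebra stable under derivation. *)
Inductive trig_poly : (R -> R) -> Prop :=
| trig_cst a : trig_poly (fun=> a)
| trig_cos : trig_poly (fun y => cos (y * k))
| trig_sin : trig_poly (fun y => sin (y * k))
| trig_add f g : trig_poly f -> trig_poly g -> trig_poly (fun y => f y + g y)
| trig_mul f g : trig_poly f -> trig_poly g -> trig_poly (fun y => f y * g y).

Lemma trig_exp f n : trig_poly f -> trig_poly (fun y => f y ^+ n).
Proof.
move=> tf; elim: n => [|n IH].
  by rewrite (_ : (fun y => _) = fun=> 1); [exact: trig_cst|exact/funext].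
rewrite (_ : (fun y => _) = fun y => f y * f y ^+ n); first exact: trig_mul.
by apply/funext => y; rewrite exprS.
Qed.

Lemma trig_poly_derive f : trig_poly f ->
  exists2 f', trig_poly f' & forall y : R, is_derive y 1 f (f' y).
Proof.
elim=> {f}.
- by move=> a; exists (fun=> 0); [exact: trig_cst|move=> y; exact: is_derive_cst].
- exists (fun y => (- k) * sin (y * k)).
    by apply: trig_mul; [exact: trig_cst|exact: trig_sin].
  move=> y; apply: is_derive_eq; rewrite /GRing.scale/=; ring.
- exists (fun y => k * cos (y * k)).
    by apply: trig_mul; [exact: trig_cst|exact: trig_cos].
  move=> y; apply: is_derive_eq; rewrite /GRing.scale/=; ring.
- move=> f g _ [f' tf' df] _ [g' tg' dg]; exists (fun y => f' y + g' y).
    exact: trig_add.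
  by move=> y; exact: is_deriveD.
- move=> f g tf [f' tf' df] tg [g' tg' dg]; exists (fun y => f y * g' y + g y * f' y).
    by apply: trig_add; exact: trig_mul.
  by move=> y; apply: is_derive_eq; rewrite /GRing.scale/=.
Qed.

Lemma trig_poly_continuous f : trig_poly f -> continuous f.
Proof.
move=> /trig_poly_derive[f' _ df] y.
by apply/differentiable_continuous/derivable1_diffP; have [] := df y.
Qed.

Lemma snd_continuous : continuous (snd : plane R -> R^o).
Proof. by move=> z; exact: cvg_snd. Qed.

Lemma differentiable_comp_snd (f : R -> R^o) (z : plane R) :
  derivable f z.2 1 -> differentiable (fun u : plane R => f u.2) z.
Proof.
move=> /derivable1_diffP df; apply: (@differentiable_comp _ _ _ _ snd f) => //.
by apply: linear_differentiable; exact: snd_continuous.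
Qed.

Lemma derive_comp_snd (f : R -> R^o) (z v : plane R) : derivable f z.2 1 ->
  'D_v (fun u : plane R => f u.2) z = derive1 f z.2 * v.2.
Proof.
move=> dfz; have /derivable1_diffP df := dfz.
have ds : differentiable (snd : plane R -> R^o) z.
  by apply: linear_differentiable; exact: snd_continuous.
rewrite deriveE; last exact: differentiable_comp_snd.
rewrite (@diff_comp _ _ _ _ snd f)//= (diff_lin _ snd_continuous) diff1E//=.
exact: mulrC.
Qed.

(** Each directional derivative is again a trigonometric polynomial in y, since ['D_v] multiplies
    the ordinary derivative by the constant [v.2]. *)
Lemma trig_poly_smooth f : trig_poly f -> smooth (fun z : plane R => f z.2).
Proof.
move=> tf s z.
have [F tF ->] : exists2 F, trig_poly F &
    iter_derive s (fun z : plane R => f z.2) = fun z => F z.2.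
  elim: s => [|v s [F tF IH]] /=; first by exists f.
  have [F' tF' dF] := trig_poly_derive tF.
  exists (fun y => F' y * v.2); first by apply: trig_mul => //; exact: trig_cst.
  apply/funext => u; rewrite IH derive_comp_snd; last by have [] := dF u.2.
  by rewrite derive1E; congr (_ * _); exact: derive_val.
have [F' _ dF] := trig_poly_derive tF.
by apply: differentiable_comp_snd; have [] := dF z.2.
Qed.

End TrigonometricPolynomials.

Lemma is_derive_affine (R : realType) (V W : normedModType R) (f : V -> W)
    (z u : V) (L : W) :
  (forall h : R, f (h *: u + z) = h *: L + f z) -> is_derive z u f L.
Proof.
move=> fL.
have h : h^-1 *: (f (h *: u + z) - f z) @[h --> 0^'] --> L.
  apply: cvg_near_cst; near=> h; rewrite fL addrK scalerA mulVf ?scale1r//.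
  by near: h; exact: nbhs_dnbhs_neq.
by split; [exact/cvgP/h|exact/cvg_lim].
Unshelve. all: by end_near.
Qed.

(** * The warped metrics and their invariance *)

Section Metric.
Variables (R : realType) (beta : R).
Hypothesis beta_gt0 : 0 < beta.

(** The square gives period [2 * beta], as that translation adds pi to the argument and flips the
    cosine. The constant keeps positivity at the zeros of the cosine. *)
Definition profile (n : nat) (y : R) : R :=
  (cos (y * (pi / (2 * beta))) ^+ 2) ^+ n + n.+1%:R^-1.

Lemma trig_profile n : trig_poly (pi / (2 * beta)) (profile n).
Proof. by apply: trig_add; [do 2 apply: trig_exp; exact: trig_cos|exact: trig_cst]. Qed.

Lemma profile_gt0 n y : 0 < profile n y.
Proof. by apply: ltr_wpDl; [exact/exprn_ge0/sqr_ge0|rewrite invr_gt0 ltr0Sn]. Qed.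

Lemma profile_even n y : profile n (- y) = profile n y.
Proof. by rewrite /profile mulNr cosN. Qed.

Lemma profile_periodic n y : profile n (y + 2 * beta) = profile n y.
Proof.
rewrite /profile mulrDl (_ : 2 * beta * _ = pi); last by field; rewrite gt_eqF.
by rewrite cosDpi sqrrN.
Qed.

Lemma profile_periodicz n (j : int) y : profile n (y + j%:~R * (2 * beta)) = profile n y.
Proof.
have h (m : nat) x : profile n (x + m%:R * (2 * beta)) = profile n x.
  elim: m x => [|m IH] x; first by rewrite mul0r addr0.
  by rewrite -natr1 mulrDl mul1r addrA profile_periodic.
case: j => m; first exact: h.
by rewrite NegzE -(h m.+1 (y + _)) mulrNz mulNr subrK.
Qed.

Variables (n : nat) (Q : R).
Hypothesis Q_gt0 : 0 < Q.

Definition gform (z u v : plane R) : R :=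
  profile n z.2 * profile n z.2 * (u.1 * v.1) + Q ^+ 2 * (u.2 * v.2).

Lemma gform_linear z a u v w :
  gform z (a *: u + v) w = a * gform z u w + gform z v w.
Proof. by rewrite /gform/= /GRing.scale/=; ring. Qed.

Lemma gform_sym z u v : gform z u v = gform z v u.
Proof. by rewrite /gform; ring. Qed.

Lemma gform_pos z u : u != 0 -> 0 < gform z u u.
Proof.
have p0 := profile_gt0 n z.2; case: u => a b u0; rewrite /gform/=.
have sq0 (x : R) : x != 0 -> 0 < x * x by rewrite -expr2 exprn_even_gt0.
have sq (x : R) : 0 <= x * x by rewrite -expr2 sqr_ge0.
have [a0|a0] := eqVneq a 0.
  rewrite a0 mul0r mulr0 add0r; apply: mulr_gt0; first exact: exprn_gt0.
  by apply: sq0; apply: contra_neq u0 => b0; rewrite a0 b0.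
apply: ltr_pwDl; first by apply: mulr_gt0; [exact: mulr_gt0|exact: sq0].
by rewrite mulr_ge0 ?sqr_ge0.
Qed.

Lemma gform_smooth u v : smooth (fun z => gform z u v).
Proof.
apply: (@trig_poly_smooth _ (pi / (2 * beta)) (fun y =>
  profile n y * profile n y * (u.1 * v.1) + Q ^+ 2 * (u.2 * v.2))).
have t := trig_profile n.
by apply: trig_add; [apply: trig_mul; [exact: trig_mul|exact: trig_cst]|exact: trig_cst].
Qed.

Lemma gform_sigma : isometric gform (@sigma R).
Proof.
have D z (u : plane R) : 'D_u (@sigma R) z = (u.1, - u.2).
  apply: derive_val; apply: is_derive_affine => h.
  by congr pair; rewrite /= /GRing.scale/=; ring.
by move=> z u v; rewrite !D /gform/= profile_even; ring.
Qed.

Lemma gform_vtrans : isometric gform (vtrans beta).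
Proof.
have D z (u : plane R) : 'D_u (vtrans beta) z = u.
  case: u => a b; apply: derive_val; apply: is_derive_affine => h.
  by congr pair; rewrite /= /GRing.scale/=; ring.
by move=> z u v; rewrite !D /gform/= profile_periodic.
Qed.

Definition kmetric : klein_metric beta := KleinMetric
  gform_linear gform_sym gform_pos gform_smooth gform_sigma gform_vtrans.

End Metric.

(** * Area and lengths of the metrics *)

Section Volume.
Variables (R : realType) (beta : R).
Hypothesis beta_gt0 : 0 < beta.
Notation mu := (@lebesgue_measure R).
Notation mu2 := (mu \x mu)%E.
Notation rect := (`[0, pi] `*` `[0, 2 * beta] : set (R * R)).

Lemma measurable_rect : measurable rect.
Proof. by apply: measurableX; exact: measurable_itv. Qed.

Lemma profile_le2 n y : profile beta n y <= 2.
Proof.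
have -> : 2 = 1 + 1 :> R by ring.
apply: lerD; last by rewrite invf_le1 ?ltr0n// ler1n.
by apply: exprn_ile1; [exact: sqr_ge0|have := cos2Dsin2 (y * (pi / (2 * beta)));
  have := sqr_ge0 (sin (y * (pi / (2 * beta)))); lra].
Qed.

(** The argument of the cosine lies strictly between 0 and pi, so its sine is positive and the
    squared cosine is below 1. *)
Lemma profile_cvg0 y : 0 < y < 2 * beta -> profile beta n y @[n --> \oo] --> 0.
Proof.
move=> /andP[y0 yb]; rewrite -(addr0 (0 : R)); apply: cvgD.
  apply: cvg_expr; rewrite ger0_norm ?sqr_ge0//.
  have : 0 < sin (y * (pi / (2 * beta))).
    have b0 : 0 < 2 * beta by rewrite mulr_gt0.
    apply: sin_gt0_pi; apply/andP; split; first
      by apply: mulr_gt0 => //; apply: divr_gt0 => //; exact: pi_gt0.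
    by rewrite mulrA ltr_pdivrMr// mulrC ltr_pM2l// pi_gt0.
  move=> /(exprn_gt0 2) s0; have := cos2Dsin2 (y * (pi / (2 * beta))); lra.
exact: cvg_harmonic.
Qed.

Lemma measurable_profile_snd n :
  measurable_fun rect (fun z : R * R => profile beta n z.2).
Proof.
apply: measurable_funTS; apply: measurableT_comp; last exact: measurable_snd.
by apply: continuous_measurable_fun; apply: trig_poly_continuous; exact: trig_profile.
Qed.

Lemma measure_rect : (mu2 rect < +oo)%E.
Proof.
have fin (b : R) : (mu `[0%R, b] < +oo)%E.
  by rewrite lebesgue_measure_itv/=; case: ifPn => _; rewrite ?ltry.
rewrite product_measure1E; [|exact: measurable_itv..].
apply: lte_mul_pinfty; [exact: measure_ge0| |exact: fin].
by rewrite ge0_fin_numE; [exact: fin|exact: measure_ge0].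
Qed.

Lemma integrable_cst_rect (a : R) : mu2.-integrable rect (cst a%:E).
Proof.
apply/integrableP; split; first exact: measurable_cst.
rewrite /= integral_cst; last exact: measurable_rect.
apply: lte_mul_pinfty; [by []|by []|exact: measure_rect].
Qed.

Lemma integrable_profile n : mu2.-integrable rect (fun z => (profile beta n z.2)%:E).
Proof.
have mr := measurable_rect.
apply: (@le_integrable _ _ _ mu2 rect mr _ (cst 2%:E)).
- by apply/measurable_EFinP; exact: measurable_profile_snd.
- move=> z _ /=; rewrite lee_fin !ger0_norm//; first exact: profile_le2.
  exact/ltW/profile_gt0.
- exact: integrable_cst_rect.
Qed.

Lemma integral_profile_cvg0 :
  (\int[mu2]_(z in rect) (profile beta n z.2)%:E @[n --> \oo] --> 0)%E.
Proof.
have mr := measurable_rect.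
suff [_ _] : [/\ mu2.-integrable rect (cst 0%E),
    (\int[mu2]_(z in rect) `|(profile beta n z.2)%:E - 0| @[n --> \oo] --> 0)%E &
    (\int[mu2]_(z in rect) (profile beta n z.2)%:E @[n --> \oo] -->
      \int[mu2]_(z in rect) 0)%E].
  by rewrite integral0.
apply: (@dominated_convergence _ _ _ mu2 rect mr
  (fun n z => (profile beta n z.2)%:E) (cst 0%E) (cst 2%:E)).
- by move=> n; apply/measurable_EFinP; exact: measurable_profile_snd.
- exact: measurable_cst.
(* Convergence to 0 fails only on the two boundary lines, where the profile tends to 1; they are
   null for the product measure. *)
- pose N : set (R * R) := setT `*` [set 0; 2 * beta].
  have mN2 : measurable ([set 0; 2 * beta] : set R).
    by apply: measurableU; exact: measurable_set1.
  have N0 : (mu2 (setT `*` [set 0%R; 2 * beta]%R) = 0)%E.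
    rewrite product_measure1E//.
    suff B0 : mu [set 0%R; (2 * beta)%R] = 0%E by rewrite [X in (_ * X)%E]B0 mule0.
    apply/eqP; rewrite eq_le measure_ge0 andbT.
    apply: (@le_trans _ _ (mu [set 0%R] + mu [set (2 * beta)%R])%E).
      by apply: measureU2; exact: measurable_set1.
    by rewrite !lebesgue_measure_set1 adde0.
  exists N; split.
  + exact: measurableX.
  + exact: N0.
  + move=> -[x y]/=; rewrite -[X in X -> _]/(~ _) => h; split => //=.
    apply: contrapT => /not_orP[/eqP y0 /eqP yb]; apply: h => -[_ /=].
    rewrite in_itv/= => /andP[y0' yb'].
    apply: cvg_EFin; first by near=> k.
    by apply: profile_cvg0; rewrite !lt_neqAle eq_sym y0 y0' yb yb'.
- exact: integrable_cst_rect.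
- apply: aeW => z k _ /=; rewrite lee_fin ger0_norm; first exact: profile_le2.
  exact/ltW/profile_gt0.
Unshelve. all: by end_near.
Qed.

Lemma vol_kmetric n (Q : R) (Q0 : 0 < Q) :
  vol (kmetric beta_gt0 n Q0) =
  Q * fine (\int[mu2]_(z in rect) (profile beta n z.2)%:E)%E.
Proof.
rewrite /vol.
transitivity (\int[mu2]_(z in rect) (Q * profile beta n z.2)).
  apply: eq_Rintegral => z _.
  rewrite [X in Num.sqrt X](_ : _ = (Q * profile beta n z.2) ^+ 2).
    by rewrite sqrtr_sqr ger0_norm// mulr_ge0// ltW// profile_gt0.
  by rewrite /= /gform/=; ring.
rewrite RintegralZl//; first exact: measurable_rect.
exact: integrable_profile.
Qed.

End Volume.

(** * Calibration estimates for curves *)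

Section Lengths.
Variables (R : realType) (beta : R).
Hypothesis beta_gt0 : 0 < beta.
Variables (n : nat) (Q : R).
Hypothesis Q_gt0 : 0 < Q.
Let g := kmetric beta_gt0 n Q_gt0.
Let sp z v := Num.sqrt (g z v v).

Let sp_ge0 z v : 0 <= sp z v. Proof. exact: sqrtr_ge0. Qed.

Lemma fst_comp_continuous (f : R -> plane R) :
  continuous f -> continuous (fun t => (f t).1 : R).
Proof. by move=> cf t; apply: cvg_comp (cf t) cvg_fst. Qed.

Lemma snd_comp_continuous (f : R -> plane R) :
  continuous f -> continuous (fun t => (f t).2 : R).
Proof. by move=> cf t; apply: cvg_comp (cf t) cvg_snd. Qed.

Let sp_cont (f h : R -> plane R) : continuous f -> continuous h ->
  continuous (fun t => sp (f t) (h t)).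
Proof.
move=> cf ch t; apply: (@continuous_comp _ _ _ (fun t => g (f t) (h t) (h t)) Num.sqrt);
  last exact: sqrt_continuous.
have cp : {for t, continuous (fun t => profile beta n (f t).2)}.
  apply: (@continuous_comp _ _ _ (fun t => (f t).2) (profile beta n)).
    exact: snd_comp_continuous.
  by apply: trig_poly_continuous; exact: trig_profile.
have c1 : {for t, continuous (fun t => (h t).1 : R)} by exact: fst_comp_continuous.
have c2 : {for t, continuous (fun t => (h t).2 : R)} by exact: snd_comp_continuous.
apply: cvgD; first by apply: cvgM; apply: cvgM.
by apply: cvgMl_tmp; exact: cvgM.
Qed.

(** The condition on [s] treats both calibrations [Q dy] and [- Q dy] at once. *)
Lemma kmetric_vert_le s z v : s ^+ 2 = Q ^+ 2 -> s * v.2 <= Num.sqrt (g z v v).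
Proof.
move=> sQ; apply: (le_trans (ler_norm _)); rewrite -sqrtr_sqr ler_wsqrtr//= /gform.
rewrite exprMn sQ.
have := mulr_ge0 (sqr_ge0 (profile beta n z.2)) (sqr_ge0 v.1); lra.
Qed.

Lemma kmetric_horiz_le z v : 1 / 2 <= profile beta n z.2 ->
  1 / 2 * v.1 <= Num.sqrt (g z v v).
Proof.
move=> p2; apply: (le_trans (ler_norm _)); rewrite -sqrtr_sqr ler_wsqrtr//= /gform.
have := mulr_ge0 (sqr_ge0 Q) (sqr_ge0 v.2).
have : 0 <= (profile beta n z.2 ^+ 2 - (1 / 2) ^+ 2) * v.1 ^+ 2.
  by rewrite mulr_ge0 ?sqr_ge0// subr_ge0 lerXn2r// nnegrE; lra.
lra.
Qed.

Lemma vert_le_length (c : R -> plane R) p q : piecewise_C1 c ->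
  0 <= p -> p <= q -> q <= 1 ->
  Q * `|(c q).2 - (c p).2| <= curve_length g c.
Proof.
move=> pc p0 pq q1.
have H s : s ^+ 2 = Q ^+ 2 -> s * ((c q).2 - (c p).2) <= curve_length g c.
  move=> sQ; have := @lin_le_length _ sp 0 s sp_ge0 sp_cont c p q pc p0 pq q1.
  rewrite !mul0r !add0r => H; rewrite mulrBr; apply: H.
  by move=> t v _; rewrite mul0r add0r; exact: kmetric_vert_le.
have [_|_] := ger0P ((c q).2 - (c p).2); first exact: H.
by rewrite mulrN -mulNr; apply: H; rewrite sqrrN.
Qed.

Lemma horiz_le_length (c : R -> plane R) : piecewise_C1 c ->
  (forall t, t \in `[0, 1] -> 1 / 2 <= profile beta n (c t).2) ->
  ((c 1).1 - (c 0).1) / 2 <= curve_length g c.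
Proof.
move=> pc pr.
have := @lin_le_length _ sp (1 / 2) 0 sp_ge0 sp_cont c 0 1 pc (lexx _) ler01 (lexx _).
rewrite !mul0r !addr0 => H; apply: le_trans (H _); first by lra.
by move=> t v t01; rewrite mul0r addr0; exact/kmetric_horiz_le/pr.
Qed.

End Lengths.

(** * Lower bounds for [l_v] and [l_sigma] *)

Section LeastLength.
Variables (R : realType) (beta : R).
Hypothesis beta_gt0 : 0 < beta.

(** Makes the set of lengths nonempty, so that a lower bound of its elements also bounds its
    [inf]. *)
Lemma straight_in_class (f : plane R -> plane R) : deck beta f ->
  closed_curve_in_class beta f (fun t => t *: f 0).
Proof.
move=> df; have dl t : is_derive t (1 : R) (fun t : R => t *: f 0) (f 0).
  by apply: is_derive_affine => h; rewrite scalerDl -scalerA scale1r.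
split.
- exists [:: 1]; split; rewrite /= ?ltr01// => -[|//] _.
  exists (fun t => t *: f 0) => //; split=> [t|]; first by have [] := dl t.
  rewrite (_ : derive1 _ = fun=> f 0); first exact: cst_continuous.
  by apply/funext => t; rewrite derive1E; apply: derive_val; exact: dl.
- by rewrite scale0r scale1r klein_proj_deck.
- exists (fun p => klein_proj beta (p.2 *: f 0)); split => //.
  + apply: continuous_subspaceT => p.
    apply: (@continuous_comp _ _ _ (fun p : R * R => p.2 *: f 0)); last first.
      exact: klein_proj_continuous.
    by apply: cvgZr_tmp; exact: cvg_snd.
  + by move=> s _ /=; rewrite scale0r scale1r klein_proj_deck.
Qed.

Lemma least_length_ge (g : klein_metric beta) f (L : R) : deck beta f ->
  (forall c, closed_curve_in_class beta f c -> L <= curve_length g c) ->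
  L <= least_length g f.
Proof.
move=> df Lc; apply: lb_le_inf.
  by eexists; exists (fun t => t *: f 0) => //; exact: straight_in_class.
by move=> _ [c cc <-]; exact: Lc.
Qed.

Variables (n : nat) (Q : R).
Hypothesis Q_gt0 : 0 < Q.
Let g := kmetric beta_gt0 n Q_gt0.

Lemma l_v_ge : 2 * beta * Q <= l_v g.
Proof.
apply: least_length_ge => [|c [pc c01 hc]]; first exact: deck_vtrans.
have cc := piecewise_C1_continuous pc.
rewrite mulrC -(vtrans_class_endpoints beta_gt0 cc c01 hc).
exact: vert_le_length.
Qed.

(* A curve in the class of sigma either stays in the strip around a reflection
   axis, where horizontal lengths are at least halved, or leaves it. *)
Lemma l_sigma_ge d :
  (forall y, `|y| < d -> 1 / 2 <= profile beta n y) -> pi <= Q * d ->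
  pi / 2 <= l_sigma g.
Proof.
move=> pd Qd; apply: least_length_ge => [|c [pc c01 hc]]; first exact: deck_sigma.
have cc := piecewise_C1_continuous pc.
have [x01 [j y01]] := sigma_class_endpoints beta_gt0 cc c01 hc.
pose a := j%:~R * (2 * beta); rewrite -/a in y01.
(* A climb of [d / 2] costs at least [Q * d / 2], which is at least [pi / 2]. *)
have vert t : t \in `[0, 1] -> d / 2 <= `|(c t).2 - (c 0).2| ->
    pi / 2 <= curve_length g c.
  rewrite in_itv/= => /andP[t0 t1] h.
  apply: le_trans (vert_le_length beta_gt0 n Q_gt0 pc (lexx _) t0 t1).
  apply: le_trans (ler_wpM2l (ltW Q_gt0) h); lra.
(* A start at distance at least [d / 2] from the axis [y = a] suffices: the end point is on the
   other side, at twice that distance. *)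
have [h0|h0] := leP (d / 2) `|(c 0).2 - a|.
  apply: (vert 1); first by rewrite in_itv/= lexx ler01.
  rewrite (_ : (c 1).2 - _ = - (2 * ((c 0).2 - a))); last by rewrite y01; ring.
  by rewrite normrN normrM ger0_norm//; have := normr_ge0 ((c 0).2 - a); lra.
(* From a start closer than [d / 2], reaching distance [d] from the axis requires a climb of
   [d / 2]. *)
have [[t [t01 ht]]|h] := pselect (exists t, t \in `[0, 1] /\ d <= `|(c t).2 - a|).
  apply: (vert t) => //.
  rewrite (_ : _ - _ = ((c t).2 - a) - ((c 0).2 - a)); last by ring.
  by apply: le_trans (lerB_dist _ _); lra.
(* The curve stays in the strip, moved to the axis [y = 0] by periodicity, and advances horizontally
   by pi. *)
rewrite -x01; apply: horiz_le_length => // t t01.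
rewrite -(profile_periodicz beta_gt0 n (- j)) mulrNz mulNr; apply: pd.
by rewrite ltNge; apply/negP => ht; apply: h; exists t.
Qed.

End LeastLength.

(** Continuity at 0, where the profile exceeds 1. The width [d] depends on [n], which the choice of
    [Q] will compensate. *)
Lemma profile_ge_half (R : realType) (beta : R) n :
  exists2 d, 0 < d & forall y, `|y| < d -> 1 / 2 <= profile beta n y.
Proof.
have c := trig_poly_continuous (trig_profile beta n) (x := 0).
have : 1 / 2 < profile beta n 0.
  rewrite /profile mul0r cos0 !expr1n.
  apply: (@lt_trans _ _ 1); first by lra.
  by rewrite ltrDl invr_gt0 ltr0Sn.
move=> /(cvgr_gt _ c)/nbhs_ballP[d /= d0 dP]; exists d => // y yd.
by apply/ltW/dP; rewrite /ball/= sub0r normrN.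
Qed.

Theorem corollary1p2 (R : realType) (beta : R) (hbeta : 0 < beta) :
  ~ (exists c : R, forall g : klein_metric beta,
       l_v g * l_sigma g <= c * vol g).
Proof.
move=> [c cP].
pose J n := fine (\int[(lebesgue_measure \x lebesgue_measure)%E]_(z in
  `[0%R, pi] `*` `[0%R, (2 * beta)%R]) (profile beta n z.2)%:E)%E.
have J0 : c * J n @[n --> \oo] --> c * 0.
  by apply: cvgMl_tmp; exact: fine_cvg (integral_profile_cvg0 hbeta).
(* The product of lengths is at least [2 * beta * Q * (pi / 2)] and the area is [Q * J n].
   Cancelling [Q] leaves [pi * beta] against [c * J n], which tends to 0 whatever the sign of
   [c]. *)
have : c * 0 < pi * beta by rewrite mulr0 mulr_gt0// pi_gt0.
move=> /(cvgr_lt _ J0)[n _ /(_ n (leqnn n))] /= cJ.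
have [d d0 dP] := profile_ge_half beta n.
(* [Q = pi / d] is the least value for which a climb of [d] costs pi; it may be chosen after [n]
   because it cancels. *)
have Q0 : 0 < pi / d by rewrite divr_gt0// pi_gt0.
have := cP (kmetric hbeta n Q0); rewrite vol_kmetric -/(J n); apply/negP; rewrite -ltNge.
have sig : pi / 2 <= l_sigma (kmetric hbeta n Q0).
  by apply: (@l_sigma_ge _ _ hbeta n _ Q0 d dP); rewrite divfK ?gt_eqF.
have v := l_v_ge hbeta n Q0.
apply: (@lt_le_trans _ _ (2 * beta * (pi / d) * (pi / 2))).
  rewrite mulrCA (_ : 2 * beta * _ * _ = pi / d * (pi * beta)); last first.
    by field; rewrite gt_eqF.
  by rewrite ltr_pM2l.
apply: ler_pM => //; first by apply/ltW/mulr_gt0 => //; exact: mulr_gt0.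
by rewrite divr_ge0// pi_ge0.
Qed.
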